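(* If the uncertainty relation $\geq_U$ on events is a qualitative probability ordering, then the strict preference $>$ on acts obtained from it by the lifting rule is not necessarily transitive. That is, there exist a finite set $S$, a set $X$ with a total preorder $\geq_P$, a qualitative probability $\geq_U$ on $2^S$, and acts $f,g,h\in X^S$ such that $f>g$ and $g>h$ but not $f>h$, where $>$ is the strict part of the relation on $X^S$ defined by $f\geq g \Leftrightarrow [f\geq g]\geq_U[g\geq f]$.
   Context: $S$ is a finite set of states, $X$ a set of consequences equipped with a total preorder $\geq_P$ (complete, transitive) having at least two elements $x,y$ with $x>_P y$. An act is a map $f:S\to X$. For acts $f,g$, $[f\geq g]=\{s\in S: f(s)\geq_P g(s)\}$. A relation $\geq_U$ on $2^S$ is a qualitative probability iff (i) it is complete and transitive; (ii) $S>_U\emptyset$ and $A\geq_U\emptyset$ for all $A\subseteq S$; (iii) for all $A,B,C\subseteq S$ with $A\cap(B\cup C)=\emptyset$: $B\geq_U C\Leftrightarrow A\cup B\geq_U A\cup C$. (Here $A>_U B$ means $A\geq_U B$ and not $B\geq_U A$.) Lifting rule: $f\geq g$ iff $[f\geq g]\geq_U[g\geq f]$; $f>g$ iff $f\geq g$ and not $g\geq f$. *)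

(* Defs.v *)
From mathcomp Require Import all_boot.
Set Implicit Arguments.
Unset Strict Implicit.
Unset Printing Implicit Defensive.

(* Relations are in the "greater than or equal" direction: [r a b] reads      *)
(* "a >= b".                                                                  *)

Definition strict (T : Type) (r : rel T) : rel T :=
  fun a b => r a b && ~~ r b a.

Record total_preorder (T : Type) (r : rel T) : Prop := TotalPreorder {
  total_preorder_total : total r;
  total_preorder_trans : transitive r
}.

Record qualitative_probability (S : finType) (geU : rel {set S}) : Prop :=
  QualitativeProbability {
    qp_preorder : total_preorder geU;
    qp_nontrivial : strict geU [set: S] set0;
    qp_ge0 : forall A : {set S}, geU A set0;
    qp_additive : forall A B C : {set S}, A :&: (B :|: C) = set0 ->
      geU B C <-> geU (A :|: B) (A :|: C)
  }.

Definition ge_event (S : finType) (X : Type) (geP : rel X) (f g : S -> X) :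
  {set S} := [set s | geP (f s) (g s)].

Definition lifting (S : finType) (X : Type) (geP : rel X) (geU : rel {set S}) :
  rel (S -> X) :=
  fun f g => geU (ge_event geP f g) (ge_event geP g f).

(* Main.v *)
Require Import Defs.
From mathcomp Require Import all_boot.

(** Condorcet's paradox: lifting compares acts by majority when all states are
    equally likely. On three states, the three cyclic shifts of a ranking of
    three consequences beat each other in a cycle. *)

Lemma card_qualitative_probability (S : finType) :
  0 < #|S| -> qualitative_probability (fun A B : {set S} => #|B| <= #|A|).
Proof.
move=> S_gt0; split.
- split=> [A B|B A C leBA leCB]; [exact: leq_total | exact: leq_trans leBA].
- by rewrite /strict cards0 cardsT leq0n -ltnNge.
- by move=> A; rewrite cards0.
- move=> A B C; rewrite setIUr => /eqP; rewrite setU_eq0 => /andP[/eqP AB0 /eqP AC0].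
  by rewrite !cardsU AB0 AC0 cards0 !subn0 leq_add2l.
Qed.

Lemma card_ge_event_ord3 (X : Type) (geP : rel X) (f g : 'I_3 -> X) :
  #|ge_event geP f g| =
  geP (f (inord 0)) (g (inord 0)) + geP (f (inord 1)) (g (inord 1))
  + geP (f (inord 2)) (g (inord 2)).
Proof.
rewrite -sum1dep_card big_mkcond.
(* With [inord i] the summand depends only on the value of [i], so the indices left by
   [big_ord_recr] compute to 0, 1, 2. *)
rewrite (eq_bigr (fun i : 'I_3 => geP (f (inord i)) (g (inord i)) : nat)).
  by rewrite 3!big_ord_recr big_ord0.
by move=> i _; rewrite inord_val; case: geP.
Qed.

(** Subtraction truncates at 0, so [k] must be at least 2 for a true cyclic shift; hence 5, 4, 3
    below. *)
Definition cyclic_act (k : nat) : 'I_3 -> nat := fun s => (k - s) %% 3.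

Theorem mainTheorem1 :
  exists (S : finType) (X : Type) (geP : rel X) (geU : rel {set S}),
    [/\ total_preorder geP,
        (exists x y : X, strict geP x y),
        qualitative_probability geU &
        exists f g h : S -> X,
          [/\ strict (lifting geP geU) f g,
              strict (lifting geP geU) g h &
              ~ strict (lifting geP geU) f h]].
Proof.
exists 'I_3, nat, (fun x y => y <= x), (fun A B : {set 'I_3} => #|B| <= #|A|); split.
- split=> [x y|y x z leyx lezy]; [exact: leq_total | exact: leq_trans leyx].
- by exists 1, 0.
- by apply: card_qualitative_probability; rewrite card_ord.
(* The values on states 0, 1, 2 are (2,1,0), (1,0,2) and (0,2,1). *)
- exists (cyclic_act 5), (cyclic_act 4), (cyclic_act 3).
  (* Each count is two to one: [f] beats [g] on states 0 and 1, [g] beats [h] on 0 and 2, [h] beats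
     [f] on 1 and 2. *)
  by split; rewrite /strict /lifting !card_ge_event_ord3 /cyclic_act !inordK.
Qed.
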